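(* Let $\mathfrak{m}$ be an infinite cardinal. Then every weakly initially $\mathfrak{m}$-compact topological space is $\mathfrak{m}$pcap.
   Context: Let $\mathfrak{m}$ be an infinite cardinal and let $X$ be a topological space. $X$ is weakly initially $\mathfrak{m}$-compact if every open cover of $X$ of cardinality $\leq \mathfrak{m}$ has a finite subset whose union is dense in $X$. $X$ is $\mathfrak{m}$pcap (''$\mathfrak{m}$-pseudocompact in the sense of complete accumulation points'') if every infinite family (set) $\mathcal{A}$ of open subsets of $X$ with $|\mathcal{A}| \leq \mathfrak{m}$ has a complete accumulation point, i.e., a point $x \in X$ such that every neighborhood of $x$ meets (has nonempty intersection with) $\kappa$ members of $\mathcal{A}$, where $\kappa = |\mathcal{A}|$. *)

(* Defs.v *)
From mathcomp Require Import all_boot all_order.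
From mathcomp Require Import boolp classical_sets functions cardinality topology.

Set Implicit Arguments.
Unset Strict Implicit.
Unset Printing Implicit Defensive.

Local Open Scope classical_set_scope.
Local Open Scope card_scope.

(** The cardinal [m] is represented by a type [M] of cardinality [m]. *)

Definition weakly_initially_compact (M : Type) (X : topologicalType) : Prop :=
  forall C : set (set X),
    C `<=` open -> \bigcup_(U in C) U = [set: X] -> C #<= [set: M] ->
    exists D : set (set X),
      [/\ D `<=` C, finite_set D & dense (\bigcup_(U in D) U)].

Definition complete_accumulation_point (X : topologicalType)
    (A : set (set X)) (x : X) : Prop :=
  forall N : set X, nbhs x N -> [set U | A U /\ N `&` U !=set0] #= A.

Definition pcap (M : Type) (X : topologicalType) : Prop :=
  forall A : set (set X),
    A `<=` open -> infinite_set A -> A #<= [set: M] ->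
    exists x : X, complete_accumulation_point A x.

(* Main.v *)
(**
Suppose that the infinite family [A] has no complete accumulation point.
Since [A] has as many members as finite sequences of members, label its members
[U_s] by such sequences [s].  For [a] in [A] let [O_a] be the complement of the
closure of the union of all [U_s] with [a] occurring in [s].

Every point [x] has a neighbourhood meeting fewer than [|A|] members of [A]; the
labels of these members involve fewer than [|A|] entries, so some [a] is missing
from all of them, and [x] lies in [O_a].  Hence the [O_a] cover [X].  On the other
hand [O_a1, ..., O_an] all miss [U_s] as soon as [a1, ..., an] occur in [s], so no
finite subfamily has a dense union.  Regular and singular cardinals are thus
treated alike.
*)
Require Import Defs.
From mathcomp Require Import all_boot all_order.
From mathcomp Require Import boolp classical_sets functions cardinality topology.

Local Open Scope classical_set_scope.
Local Open Scope card_scope.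

(** * Cardinal arithmetic of infinite sets *)

Lemma injective_card_le (T U : Type) (f : T -> U) :
  injective f -> [set: T] #<= [set: U].
Proof.
move=> finj; elim/Ppointed: U f finj => U f finj.
  by rewrite emptyE; apply/eqP/seteqP; split=> // x; case: (no (f x)).
by apply/pcard_injP; exists f => x y _ _; apply: finj.
Qed.

Lemma card_le_injective (T U : Type) :
  [set: T] #<= [set: U] -> exists f : T -> U, injective f.
Proof.
elim/Ppointed: U => U.
  rewrite emptyE => /eqP T0.
  have noT (t : T) : False by have : [set: T] t by []; rewrite T0.
  by exists (fun t => False_rect U (noT t)) => t; case: (noT t).
by move=> /pcard_injP[f finj]; exists f => x y; apply: finj; rewrite inE.
Qed.

(** Zorn's lemma for graphs of partial injections: if a maximal graph missed a point on each side,
    the pair of these points could be added. *)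
Lemma card_le_total (T' U' : Type) (A : set T') (B : set U') :
  A #<= B \/ B #<= A.
Proof.
rewrite -(card_le_eql (card_setT A)) -(card_le_eqr (card_setT B)).
rewrite -(card_le_eql (card_setT B)) -(card_le_eqr (card_setT A)).
move: (set_type A) (set_type B) => {T' U' A B} T U.
pose P (G : set (T * U)) := forall p q, G p -> G q -> p.1 = q.1 <-> p.2 = q.2.
have [F FP Ftot|G [PG Gmax]] := @Zorn_bigcup _ P.
  move=> p q [G FG Gp] [H FH Hq].
  by have [GH|HG] := Ftot _ _ FG FH; [apply: (FP H) => //; apply: GH
                                     |apply: (FP G) => //; apply: HG].
have [Gl|/existsNP[t tG]] := pselect (forall t, exists u, G (t, u)).
  have [f fG] := choice Gl; left; apply: (injective_card_le _ _ f) => x y fxy.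
  exact: (PG _ _ (fG x) (fG y)).2.
have [Gr|/existsNP[u uG]] := pselect (forall u, exists t, G (t, u)).
  have [f fG] := choice Gr; right; apply: (injective_card_le _ _ f) => x y fxy.
  exact: (PG _ _ (fG x) (fG y)).1.
case: (Gmax ((t, u) |` G)).
  split=> [|sub]; first by move=> p; right.
  by apply: tG; exists u; apply: sub; left.
move=> [x y] [x' y'] [[-> ->]|Gp] [[-> ->]|Gq] //=.
- by split=> E; [case: tG; exists y'; rewrite E|case: uG; exists x'; rewrite E].
- by split=> E; [case: tG; exists y; rewrite -E|case: uG; exists x; rewrite -E].
- exact: (PG _ _ Gp Gq).
Qed.

(* Zorn's lemma for the injections [f : D * D -> D] with [D] containing a fixed
   countable set: at a maximal [(D, f)] there is no injection [g] of [D] into its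
   complement, for [f] would extend to the square of [D `|` g @` D]. *)
Lemma infinite_card_square (T : Type) :
  infinite_set [set: T] -> [set: T * T] #<= [set: T].
Proof.
move=> /infiniteP; elim/Ppointed: T => T; first by rewrite emptyE => /eqP/seteqP[/(_ 0 I)].
move=> /card_le_injective[e einj].
pose D0 := range e.
(* A partial injection is its domain [p.1] with a total operation [p.2], whose values off the domain
   are ignored; [le] is extension. *)
pose good (p : set T * (T -> T -> T)) :=
  [/\ D0 `<=` p.1, (forall x y, p.1 x -> p.1 y -> p.1 (p.2 x y)) &
      forall x y x' y', p.1 x -> p.1 y -> p.1 x' -> p.1 y' ->
        p.2 x y = p.2 x' y' -> (x, y) = (x', y')].
pose le (p q : set T * (T -> T -> T)) :=
  p.1 `<=` q.1 /\ (forall x y, p.1 x -> p.1 y -> p.2 x y = q.2 x y).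
have [d dK] : exists d : T -> nat, cancel e d.
  have /choice[d dP] : forall t, exists n, D0 t -> e n = t.
    move=> t.
    by have [[n _ <-]|nD0] := pselect (D0 t); [exists n|exists 0].
  by exists d => n; apply: einj; apply: dP; exists n.
have good0 : good (D0, fun x y => e (pickle (d x, d y))).
  split=> //= [x y _ _|x y x' y' [a _ <-] [b _ <-] [a' _ <-] [b' _ <-]].
    by exists (pickle (d x, d y)).
  by rewrite !dK => /einj/(pcan_inj pickleK)[-> ->].
pose R (p q : {p | good p}) := `[< le (sval p) (sval q) >].
have [|||[[D f] gDf] fmax] := @ZL_preorder _ (exist _ _ good0) R.
- by move=> p; apply/asboolP; split.
- move=> q p r /asboolP[pq pqE] /asboolP[qr qrE]; apply/asboolP; split.
    by move=> x /pq/qr.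
  by move=> x y px py; rewrite pqE ?qrE //; apply: pq.
- move=> A Atot.
  have [[p0 Ap0]|A0] := pselect (A !=set0); last first.
    by exists (exist _ _ good0) => s As; case: A0; exists s.
  (* A nonempty chain is bounded by the union of its domains: any two points lie in a common domain,
     and all such members agree there. *)
  pose D x := exists2 p, A p & (sval p).1 x.
  have D2 x y : D x -> D y -> exists p, [/\ A p, (sval p).1 x & (sval p).1 y].
    move=> [p Ap px] [q Aq qy].
    by have [/asboolP[pq _]|/asboolP[qp _]] := Atot _ _ Ap Aq;
      [exists q|exists p]; split=> //; [apply: pq|apply: qp].
  have /choice[f fE] : forall xy, exists z, forall p, A p -> (sval p).1 xy.1 ->
      (sval p).1 xy.2 -> z = (sval p).2 xy.1 xy.2.
    move=> [x y] /=.
    have [[p [Ap px py]]|nE] :=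
      pselect (exists p, [/\ A p, (sval p).1 x & (sval p).1 y]); last first.
      by exists x => p Ap px py; case: nE; exists p.
    exists ((sval p).2 x y) => q Aq qx qy.
    by have [/asboolP[_ ->]|/asboolP[_ ->]] := Atot _ _ Ap Aq.
  have goodD : good (D, fun x y => f (x, y)).
    split=> /= [x D0x|x y Dx Dy|x y x' y' Dx Dy Dx' Dy'].
    - by exists p0 => //; case: (svalP p0) => + _ _; apply.
    - have [p [Ap px py]] := D2 _ _ Dx Dy.
      rewrite (fE (x, y) p) //=; exists p => //.
      by case: (svalP p) => _ + _; apply.
    - have [p [Ap px py]] := D2 _ _ Dx Dy.
      have [q [Aq qx' qy']] := D2 _ _ Dx' Dy'.
      rewrite (fE (x, y) p) // (fE (x', y') q) //=.
      have [/asboolP[pq pqE]|/asboolP[qp qpE]] := Atot _ _ Ap Aq.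
        by rewrite pqE //; case: (svalP q) => _ _; apply=> //; apply: pq.
      by rewrite qpE //; case: (svalP p) => _ _; apply=> //; apply: qp.
  exists (exist _ _ goodD) => p Ap; apply/asboolP; split=> /= [x px|x y px py].
    by exists p.
  by rewrite (fE (x, y) p).
have [/= D0D fD finj] := gDf.
have De n : D (e n) by apply: D0D; exists n.
have e01 : e 0 <> e 1 by move=> /einj.
(* [f (e 0)] and [f (e 1)] embed two disjoint copies of [D] in [D], leaving room for a set [E] that
   injects into [D]. *)
have pair_inj (E : set T) (h : T -> T) :
    (forall x, E x -> D (h x)) ->
    (forall x y, E x -> E y -> h x = h y -> x = y) ->
    exists k : T -> T, (forall x, D x \/ E x -> D (k x)) /\
      (forall x y, D x \/ E x -> D y \/ E y -> k x = k y -> x = y).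
  move=> hD hinj.
  exists (fun x => if `[< D x >] then f (e 0) x else f (e 1) (h x)); split.
    by move=> x; case: asboolP => [Dx _|nDx [//|Ex]]; apply: fD => //; apply: hD.
  move=> x y; case: asboolP => [Dx _|nDx [//|Ex]];
    case: asboolP => [Dy _|nDy [//|Ey]].
  - by case/(finj _ _ _ _ (De 0) Dx (De 0) Dy).
  - by case/(finj _ _ _ _ (De 0) Dx (De 1) (hD y Ey)).
  - by case/(finj _ _ _ _ (De 1) (hD x Ex) (De 0) Dy) => /esym.
  - by case/(finj _ _ _ _ (De 1) (hD x Ex) (De 1) (hD y Ey)) => /hinj ->.
have [/pcard_leP[h]|/pcard_leP[g]] := card_le_total _ _ (~` D) D.
  have [||k [kD kinj]] := pair_inj (~` D) h.
  - by move=> x nDx; apply: funS.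
  - by move=> x y nDx nDy; apply: inj; rewrite inE.
  apply: (injective_card_le _ _ (fun xy => f (k xy.1) (k xy.2))).
  have all x : D x \/ (~` D) x by apply: EM.
  move=> [x y] [x' y'] /= E.
  have Dk z : D (k z) by apply: kD.
  by have [/kinj -> // /kinj ->] := finj _ _ _ _ (Dk x) (Dk y) (Dk x') (Dk y') E.
have gD x : D x -> ~ D (g x) by move=> Dx; apply: 'funS_g.
have ginj x y : D x -> D y -> g x = g y -> x = y.
  by move=> Dx Dy; apply: inj; rewrite inE.
have /choice[h hP] : forall y, exists x, (g @` D) y -> D x /\ g x = y.
  move=> y.
  by have [[x Dx <-]|nE] := pselect ((g @` D) y); [exists x|exists y].
have [||k [kD kinj]] := pair_inj (g @` D) h.
- by move=> y /hP[].
- by move=> x y /hP[_ {2}<-] /hP[_ {2}<-] ->.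
pose f' x y := if `[< D x /\ D y >] then f x y else g (f (k x) (k y)).
have good' : good (D `|` g @` D, f').
  split=> /= [x /D0D Dx|x y Dx Dy|x y x' y' Dx Dy Dx' Dy']; first by left.
    rewrite /f'; case: asboolP => [[? ?]|_]; [left; exact: fD|right].
    by exists (f (k x) (k y)) => //; apply: fD; apply: kD.
  have [Dkx Dky] := (kD _ Dx, kD _ Dy).
  have [Dkx' Dky'] := (kD _ Dx', kD _ Dy').
  rewrite /f'; case: asboolP => [[? ?]|_]; case: asboolP => [[? ?]|_].
  - exact: finj.
  - by move=> E; case: (gD (f (k x') (k y'))); rewrite -?E; apply: fD.
  - by move=> E; case: (gD (f (k x) (k y))); rewrite ?E; apply: fD.
  - move=> /ginj-/(_ (fD _ _ Dkx Dky) (fD _ _ Dkx' Dky')).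
    by case/(finj _ _ _ _ Dkx Dky Dkx' Dky') => /kinj -> // /kinj ->.
have /asboolP[sub _] : R (exist _ _ good') (exist _ _ gDf).
  apply: fmax; apply/asboolP; split=> /= [x Dx|x y Dx Dy]; first by left.
  by rewrite /f'; case: asboolP => // -[].
by case: (gD _ (De 0)); apply: sub; right; exists (e 0).
Qed.

(** Iterated pairing codes the entries injectively once the length is fixed, so the length is coded
    alongside. *)
Lemma infinite_card_seq (T : Type) :
  infinite_set [set: T] -> [set: seq T] #<= [set: T].
Proof.
move=> Tinf; have /card_le_injective[p pinj] := infinite_card_square _ Tinf.
have /infiniteP/card_le_injective[e einj] := Tinf.
pose c := foldr (fun x t => p (x, t)) (e 0).
apply: (injective_card_le _ _ (fun s => p (e (size s), c s))).
move=> s1 s2 /pinj[/einj]; elim: s1 s2 => [|x s1 IH] [|y s2] //= [sz].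
by move=> /pinj[-> /(IH _ sz)->].
Qed.

(** A finite [B] would make [I] finite. Otherwise [i] is determined by some [b] and its position in
    [s b]. *)
Lemma card_le_seq_cover (I : choiceType) (B : set I) (s : I -> seq I) :
  infinite_set [set: I] -> (forall i, exists2 b, B b & i \in s b) ->
  [set: I] #<= B.
Proof.
move=> Iinf cov.
have [Bfin|Binf] := pselect (finite_set B).
  case: Iinf; apply: sub_finite_set (bigcup_finite Bfin (fun b _ => finite_seq (s b))).
  by move=> i _; have [b Bb ib] := cov i; exists b.
have {}cov i : exists b : B, i \in s (val b).
  by have [b Bb ib] := cov i; exists (SigSub (mem_set Bb)).
have [b bP] := choice cov.
apply: (card_le_trans (B := [set: seq B])).
  (* The length stores the position; the successor keeps the sequence nonempty, so that [b i] can be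
     read off. *)
  apply: (injective_card_le _ _ (fun i => nseq (index i (s (val (b i)))).+1 (b i))).
  move=> i j [bij /(congr1 size)]; rewrite !size_nseq bij => ij.
  by rewrite -(nth_index i (bP i)) bij ij nth_index // -bij.
rewrite -(card_le_eqr (card_setT B)); apply: infinite_card_seq.
by rewrite (eq_finite_set (card_setT B)).
Qed.

(** * The open cover attached to a labelling of the family *)

Theorem theorem1 (M : Type) (infM : infinite_set [set: M])
    (X : topologicalType) (hX : weakly_initially_compact M X) :
  pcap M X.
Proof.
move=> A Aop Ainf AM; apply: contrapT => noacc.
have Ainf' : infinite_set [set: A] by rewrite (eq_finite_set (card_setT A)).
(* The label of [a] is [s a], with [s] a left inverse of an injection [c]; it is arbitrary off the
   range of [c]. *)
have [s ssurj] : exists s : A -> seq A, forall l, exists a, s a = l.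
  have /card_le_injective[c cinj] := infinite_card_seq _ Ainf'.
  have /choice[s sP] : forall a, exists l', forall l, c l = a -> l' = l.
    move=> a.
    have [[l <-]|nE] := pselect (exists l, c l = a).
      by exists l => l' /cinj.
    by exists [::] => l' E; case: nE; exists l'.
  by exists s => l; exists (c l); apply: sP.
pose W (a : A) := \bigcup_(b in [set b : A | a \in s b]) val b.
pose O a := ~` closure (W a).
have [D [DO Dfin Ddense]] : exists D : set (set X),
    [/\ D `<=` range O, finite_set D & dense (\bigcup_(U in D) U)].
  apply: hX => [_ [a _ <-]||].
  - by apply: closed_openC; apply: closed_closure.
  - apply/seteqP; split=> // x _.
    have /existsNP[N /not_implyP[Nx /negP NA]] : ~ complete_accumulation_point A x.
      by move=> acc; apply: noacc; exists x.
    pose B := [set b : A | N `&` val b !=set0].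
    (* Otherwise the labels of [B] exhaust [A], so [B] is as large as [A], against the choice of
       [N]. *)
    have [a aB] : exists a, forall b, B b -> a \notin s b.
      apply: contrapT => nE; case/negP: NA; rewrite card_eq_le; apply/andP; split.
        by apply: subset_card_le => U [].
      have AB : [set: A] #<= B.
        apply: (card_le_seq_cover _ _ s) => // a; apply: contrapT => nb.
        apply: nE; exists a => b Bb; apply/negP => ab.
        by apply: nb; exists b.
      rewrite -(card_le_eql (card_setT A)); apply: (card_le_trans AB).
      apply: (card_le_trans (B := val @` B)).
        have : val @` B #= B by apply: inj_card_eq => a b _ _ /val_inj.
        by rewrite card_eq_le => /andP[].
      by apply: subset_card_le => _ [b Bb <-]; split=> //; apply: set_valP.
    exists (O a) => //; move=> /(_ N Nx)[y [[b ab by'] Ny]].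
    suff /negP[] : a \notin s b by [].
    by apply: aB; exists y.
  - apply: (card_le_trans (card_image_le _ _)).
    by rewrite (card_le_eql (card_setT A)).
have [a0 _] := infinite_setN0 Ainf'.
have [r Dr] := (finite_seqP _).1 Dfin.
have /choice[c cP] : forall U, exists a, D U -> O a = U.
  move=> U.
  by have [/DO[a _ <-]|nD] := pselect (D U); [exists a|exists a0].
have [b1 sb1] := ssurj (map c r).
(* The extra entry [a0] changes the length of the label, so [b2] differs from [b1]. *)
have [b2 sb2] := ssurj (a0 :: map c r).
(* At most one member of [A] is empty, hence the two candidates. *)
have [b [sub bn0]] : exists b, {subset map c r <= s b} /\ val b !=set0.
  have [b1n|b1e] := pselect (val b1 !=set0).
    by exists b1; split; [rewrite sb1|exact: b1n].
  exists b2; rewrite sb2; split; first by move=> a ain; rewrite inE ain orbT.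
  apply/set0P/negP => /eqP b2e; move/set0P/negP/negPn/eqP: b1e => b1e.
  have b12 : b1 = b2 by apply: val_inj; rewrite b1e.
  by move: sb2; rewrite -b12 sb1 => /(congr1 size)/n_Sn.
(* For each [U] in [D], [val b] lies in [W (c U)] and so misses [O (c U) = U], against density. *)
have [y [by' [U DU Uy]]] := Ddense _ bn0 (Aop _ (set_valP b)).
have : ~ closure (W (c U)) y by have := Uy; rewrite -{1}(cP U DU).
apply; apply: subset_closure; exists b => //=.
by apply: sub; apply: map_f; move: DU; rewrite Dr.
Qed.
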